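(* Assume that $\tilde\theta\in\mathbb{R}$, $\tilde\varphi\in\mathcal{C}^1(E\times\mathbb{R},\mathbb{R})$ and $\tilde\Upsilon\subset M\times\mathbb{R}$ is a closed set. Let $$\tilde\Gamma:=\left\{\tilde\gamma\in\mathcal{C}([0,1],M\times\mathbb{R}):\tilde\gamma(0)\in\tilde\Upsilon,\ \tilde\varphi(\tilde\gamma(1))<\tilde\theta\right\}.$$ If $\tilde\varphi$ satisfies $$\tilde a:=\inf_{\tilde\gamma\in\tilde\Gamma}\max_{t\in[0,1]}\tilde\varphi(\tilde\gamma(t))>\tilde b:=\sup_{\tilde\gamma\in\tilde\Gamma}\max\{\tilde\varphi(\tilde\gamma(0)),\tilde\varphi(\tilde\gamma(1))\},$$ then, for every $\varepsilon\in(0,(\tilde a-\tilde b)/2)$, $\delta>0$ and $\tilde\gamma_*\in\tilde\Gamma$ such that $\sup_{t\in[0,1]}\tilde\varphi(\tilde\gamma_*(t))\le\tilde a+\varepsilon$, there exists $(v,\tau)\in M\times\mathbb{R}$ such that (i) $\tilde a-2\varepsilon\le\tilde\varphi(v,\tau)\le\tilde a+2\varepsilon$; (ii) $\min_{t\in[0,1]}\|(v,\tau)-\tilde\gamma_*(t)\|_{E\times\mathbb{R}}\le2\delta$; (iii) $\left\|\tilde\varphi|_{M\times\mathbb{R}}'(v,\tau)\right\|\le\frac{8\varepsilon}\delta$.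
   Context: $H$ is a real Hilbert space with scalar product $(\cdot,\cdot)_H$ and norm $\|\cdot\|_H$, $E$ is a real Banach space with norm $\|\cdot\|_E$, both infinite dimensional, with continuous injections $E\hookrightarrow H\hookrightarrow E^*$ ($E^*$ the dual of $E$, $H$ identified with its dual). $M:=\{u\in E:\|u\|_H=1\}$ with the topology inherited from $E$. $E\times\mathbb{R}$ carries the norm $\|(u,\tau)\|_{E\times\mathbb{R}}=\sqrt{\|u\|_E^2+\tau^2}$. For $(u,\tau)\in M\times\mathbb{R}$, $\tilde T_{(u,\tau)}(M\times\mathbb{R})=\{(v,\sigma)\in E\times\mathbb{R}:(u,v)_H=0\}$, and $\|\tilde\varphi|_{M\times\mathbb{R}}'(u,\tau)\|:=\sup\{|\langle\tilde\varphi'(u,\tau),(v,\sigma)\rangle|:(v,\sigma)\in\tilde T_{(u,\tau)}(M\times\mathbb{R}),\ \|(v,\sigma)\|_{E\times\mathbb{R}}=1\}$. *)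

(* Defs.v *)
From HB Require Import structures.
From mathcomp Require Import all_boot all_order all_algebra.
From mathcomp Require Import all_classical all_reals all_analysis.
Set Implicit Arguments.
Unset Strict Implicit.
Unset Printing Implicit Defensive.
Import Order.TTheory GRing.Theory Num.Theory.
Import numFieldNormedType.Exports.
Local Open Scope classical_set_scope.
Local Open Scope ring_scope.

(* Suprema and infima are taken in [\bar R], so that no default value is
   involved; in particular the infimum over an empty class of paths is +oo and
   the supremum is -oo. *)

Definition infinite_dimensional (R : realType) (V : lmodType R) : Prop :=
  forall (n : nat) (b : 'I_n -> V),
    exists x : V, forall c : 'I_n -> R, x <> \sum_(i < n) c i *: b i.

Definition opnorm (R : realType) (V : normedModType R) (f : V -> R) : \bar R :=
  ereal_sup [set `|f v|%:E | v in [set v : V | `|v| <= 1]].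

(* The library norm on a product is the max norm.  It is equivalent to
   [prod_norm] below, so the topology, the differential and the continuity of
   the differential do not depend on which of the two is used. *)
Definition C1 (R : realType) (V : normedModType R) (f : V -> R) : Prop :=
  (forall x : V, differentiable f x) /\
  (forall (x : V) (e : R), 0 < e ->
     \forall y \near x, (opnorm (fun v : V => 'd f y v - 'd f x v)%R <= e%:E)%E).

(* With [iota] the injection of E into H and H identified with its dual by the
   scalar product, this is the map from H to the dual of E. *)
Definition to_dual (R : realType) (H E : normedModType R)
    (dot : {dot H for idfun}) (iota : {linear E -> H}) (h : H) : E -> R :=
  fun u => dot h (iota u).

(* Continuity of the linear map from H to the dual of E is its boundedness for
   the dual norm. *)
Definition embedded_triple (R : realType) (H E : normedModType R)
    (dot : {dot H for idfun}) (iota : {linear E -> H}) : Prop :=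
  [/\ injective iota,
      continuous iota,
      injective (to_dual dot iota) &
      exists C : R, forall h : H,
        (opnorm (to_dual dot iota h) <= (C * `|h|)%:E)%E].

Definition prod_norm (R : realType) (E : normedModType R) (x : E * R) : R :=
  Num.sqrt (`|x.1| ^+ 2 + x.2 ^+ 2).

Definition sphere (R : realType) (H E : normedModType R)
    (iota : {linear E -> H}) : set E :=
  [set u | `|iota u| = 1].

Definition sphereR (R : realType) (H E : normedModType R)
    (iota : {linear E -> H}) : set (E * R) :=
  sphere iota `*` setT.

Definition tangent (R : realType) (H E : normedModType R)
    (dot : {dot H for idfun}) (iota : {linear E -> H}) (x : E * R) :
    set (E * R) :=
  [set y | dot (iota x.1) (iota y.1) = 0].

Definition constrained_diff_norm (R : realType) (H E : normedModType R)
    (dot : {dot H for idfun}) (iota : {linear E -> H})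
    (phi : E * R -> R) (x : E * R) : \bar R :=
  ereal_sup [set `|'d phi x y|%:E |
    y in [set y | tangent dot iota x y /\ prod_norm y = 1]].

(* Paths are functions on the whole of R of which only the restriction to
   [0, 1] matters. *)
Definition paths (R : realType) (H E : normedModType R)
    (iota : {linear E -> H}) (Upsilon : set (E * R)) (phi : E * R -> R)
    (theta : R) : set (R -> E * R) :=
  [set gamma | [/\ {within `[0 : R, 1 : R], continuous gamma},
                   gamma @` `[0, 1] `<=` sphereR iota,
                   Upsilon (gamma 0) &
                   phi (gamma 1) < theta]].

(* A maximum when f is continuous along the path: see [path_sup_attained]. *)
Definition path_sup (R : realType) (E : normedModType R) (f : E * R -> R)
    (gamma : R -> E * R) : \bar R :=
  ereal_sup [set (f (gamma t))%:E | t in `[0, 1]].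

(* A minimum when gamma is continuous: see [path_dist_attained]. *)
Definition path_dist (R : realType) (E : normedModType R) (x : E * R)
    (gamma : R -> E * R) : \bar R :=
  ereal_inf [set (prod_norm (x - gamma t))%:E | t in `[0, 1]].

Definition minimax_level (R : realType) (E : normedModType R)
    (phi : E * R -> R) (Gamma : set (R -> E * R)) : \bar R :=
  ereal_inf [set path_sup phi gamma | gamma in Gamma].

Definition endpoint_level (R : realType) (E : normedModType R)
    (phi : E * R -> R) (Gamma : set (R -> E * R)) : \bar R :=
  ereal_sup [set (Num.max (phi (gamma 0)) (phi (gamma 1)))%:E |
    gamma in Gamma].

Lemma path_sup_attained (R : realType) (E : normedModType R) (f : E * R -> R)
    (gamma : R -> E * R) :
  continuous f -> {within `[0 : R, 1 : R], continuous gamma} ->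
  exists2 t, t \in `[0, 1] & path_sup f gamma = (f (gamma t))%:E.
Proof.
move=> cf cg.
have cfg : {within `[0 : R, 1 : R], continuous (f \o gamma)}.
  by move=> t; apply: cvg_comp; [exact: cg | exact: cf].
have [t t01 tmax] := EVT_max ler01 cfg.
exists t => //; apply/eqP; rewrite eq_le; apply/andP; split.
  by apply: ge_ereal_sup => _ [s s01 <-]; rewrite lee_fin; exact: tmax.
by apply: ereal_sup_ubound; exists t.
Qed.

Lemma path_dist_attained (R : realType) (E : normedModType R) (x : E * R)
    (gamma : R -> E * R) :
  {within `[0 : R, 1 : R], continuous gamma} ->
  exists2 t, t \in `[0, 1] &
    path_dist x gamma = (prod_norm (x - gamma t))%:E.
Proof.
move=> cg.
have cf : continuous (fun y : E * R => prod_norm (x - y)).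
  move=> y; rewrite /prod_norm.
  apply: (@continuous_comp _ _ _ (fun y : E * R =>
      `|(x - y).1| ^+ 2 + (x - y).2 ^+ 2) (@Num.sqrt R)); last first.
    exact: sqrt_continuous.
  have cB : (x - z) @[z --> y] --> x - y by apply: cvgB; [exact: cvg_cst|exact: cvg_id].
  apply: cvgD; rewrite !expr2; apply: cvgM; try apply: cvg_norm;
  by first [exact: (cvg_comp _ _ cB (@cvg_fst _ _ _ _ _)) | exact: (cvg_comp _ _ cB (@cvg_snd _ _ _ _ _))].
have cfg : {within `[0 : R, 1 : R], continuous (fun t => prod_norm (x - gamma t))}.
  move=> t; apply: (@cvg_comp _ _ _ gamma (fun y => prod_norm (x - y))).
    exact: cg.
  exact: cf.
have [t t01 tmin] := EVT_min ler01 cfg.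
exists t => //; apply/eqP; rewrite eq_le; apply/andP; split.
  by apply: ereal_inf_lbound; exists t.
by apply: le_ereal_inf_tmp => _ [s s01 <-]; rewrite lee_fin; exact: tmin.
Qed.

(* Main.v *)
Require Import Defs.
From HB Require Import structures.
From mathcomp Require Import all_boot all_order all_algebra.
From mathcomp Require Import all_classical all_reals all_analysis.
From mathcomp Require Import ring lra.
Import Order.TTheory GRing.Theory Num.Theory.
Import numFieldNormedType.Exports.
Local Open Scope classical_set_scope.
Local Open Scope ring_scope.

(** Ekeland's variational principle, applied in a space of paths, replaces the
    usual flow of a pseudo-gradient field.

    Fix the endpoints of gamma, let k = eps / delta, and for a path g write
    max g for the largest value of phi along it.  The paths on the constrained
    set with these endpoints form a complete space for the uniform distance;
    all of them belong to Gamma, so that max g >= a.  As max gamma <= a + eps,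
    Ekeland's principle ([ekeland_path]) gives a path g at distance at most
    eps / k = delta from gamma for which no path g' <> g satisfies
    max g' <= max g - k * dist (g', g).

    Some point of g at a level >= a - 2 eps has slope at most 4 k, hence is a
    point sought.  Otherwise each of these points has a tangent direction along
    which phi decreases at a rate > 4 k.  Such a direction, projected on the
    nearby tangent spaces, keeps its rate at the nearby points of g, and the
    directions with this property form a convex set; so they can be glued into
    one continuous field along g ([continuous_selection], [descent_field]).
    The field can be taken to be 0 at the endpoints, because these lie strictly
    below the level a - 2 eps.  Moving the points of g for a short time h along
    the field and back onto the sphere yields a path with the same endpoints,
    at distance at most 2 h from g, whose maximum is smaller by at least 2 k h
    ([descent]), against the choice of g.

    The argument runs in the max norm of E * R; comparing it with the Euclidean
    product norm costs a factor 2 in the distance, and the factor 8 allowed for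
    the slope leaves room for the rest.  Paths are made continuous on the whole
    line by precomposing them with the projection [clamp] on [0, 1]. *)

(** * An ordering form of the variational principle *)

(** The Brezis-Browder ordering principle.  Choose inductively below each
    [u n] an element [u n.+1] that minimizes I up to 1 / (n + 1); a lower bound
    of this decreasing sequence is I-minimal, since everything below it is also
    below every [u n]. *)
Lemma brezis_browder {R : realType} {T : Type} (le : T -> T -> Prop)
    (I : T -> R) (m : R) :
  (forall x, le x x) ->
  (forall y x z, le x y -> le y z -> le x z) ->
  (forall x y, le x y -> I x <= I y) ->
  (forall x, m <= I x) ->
  (forall u : nat -> T, (forall n, le (u n.+1) (u n)) ->
     exists x, forall n, le x (u n)) ->
  forall x0, exists2 x, le x x0 & forall y, le y x -> I x <= I y.
Proof.
move=> leR leT I_mono I_ge lower_bound x0.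
have almost_min (p : T * nat) : exists y,
    le y p.1 /\ forall z, le z p.1 -> I y <= I z + p.2.+1%:R^-1.
  have Ip : has_inf [set I z | z in [set z | le z p.1]].
    by split; [exists (I p.1), p.1; [exact: leR|] | exists m => _ [z _ <-]].
  have e0 : 0 < p.2.+1%:R^-1 :> R by rewrite invr_gt0 ltr0n.
  have [_ [y yp <-] yI] := inf_adherent e0 Ip.
  exists y; split => // z zp; apply: le_trans (ltW yI) _.
  by rewrite lerD2r; apply: ge_inf; [case: Ip | exists z].
have [f fP] := choice almost_min.
pose u := fix u n := if n is k.+1 then f (u k, k) else x0.
have u_le n : le (u n.+1) (u n) by have [] := fP (u n, n).
have [x xu] := lower_bound u u_le.
exists x; first exact: (xu 0%N).
move=> y yx; apply/ler_addgt0Pr => e e0.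
have [n ne] : exists n, n.+1%:R^-1 < e.
  exists (Num.truncn e^-1); rewrite -[ltRHS]invrK ltf_pV2 ?posrE ?invr_gt0//.
  by rewrite truncnS_gt.
apply: (le_trans (I_mono _ _ (xu n.+1))) => /=.
have [_ /(_ y)] := fP (u n, n); move=> /(_ (leT _ _ _ yx (xu n))) /= h.
by apply: le_trans h _; rewrite lerD2l ltW.
Qed.

(** * Paths extended constantly beyond [0, 1] *)

Section clamp.
Context {R : realType}.
Implicit Type t : R.

Definition clamp t : R := Num.max 0 (Num.min 1 t).

Lemma clamp_itv t : 0 <= clamp t <= 1.
Proof. by rewrite /clamp le_max lexx /= ge_max ler01 ge_min lexx. Qed.

Lemma clamp_id t : 0 <= t <= 1 -> clamp t = t.
Proof. by case/andP=> t0 t1; rewrite /clamp min_r // max_r. Qed.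

Lemma clampK t : clamp (clamp t) = clamp t.
Proof. exact/clamp_id/clamp_itv. Qed.

Lemma continuous_clamp : continuous clamp.
Proof.
move=> t; have cmin : {for t, continuous (cst 1 \min id : R -> R^o)}.
  by apply: continuous_min; [exact: cvg_cst | exact: cvg_id].
by apply: (continuous_max _ cmin); exact: cvg_cst.
Qed.

Lemma continuous_clamp_comp (V : topologicalType) (g : R -> V) :
  {within `[0, 1], continuous g} -> continuous (g \o clamp).
Proof.
move=> cg t; have ct : `[0, 1]%classic (clamp t).
  by rewrite /= in_itv /= clamp_itv.
have gt : g @ within `[0, 1]%classic (nbhs (clamp t)) --> g (clamp t).
  by rewrite nbhs_subspace_in //; exact: cg.
move=> U /gt /(continuous_clamp t) /=; rewrite nbhs_simpl /=.
apply: filterS => s /=; apply.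
by rewrite in_itv /= clamp_itv.
Qed.

End clamp.

(** * Continuous selection on an interval *)

Lemma lt_convex {R : realType} (c a b M : R) : 0 <= c <= 1 -> a < M -> b < M ->
  (1 - c) * a + c * b < M.
Proof.
move=> /andP[c0 c1] aM bM.
have [->|cn1] := eqVneq c 1; first by rewrite subrr mul0r add0r mul1r.
have c1' : 0 < 1 - c by rewrite subr_gt0 lt_neqAle cn1.
have : (1 - c) * a < (1 - c) * M by rewrite ltr_pM2l.
have : c * b <= c * M by rewrite ler_wpM2l// ltW.
lra.
Qed.

Definition convex_valued {R : realType} {V : normedModType R}
  (F : R -> set V) := forall t v w (c : R), 0 <= c <= 1 -> F t v -> F t w ->
    F t ((1 - c) *: v + c *: w).

(** A special case of Michael's theorem, by continuation along the interval: a
    selection on [a, s1] is continued beyond the supremum s of the reachable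
    points by blending it, just before s1, with the constant selection valid
    around s. *)
Lemma continuous_selection {R : realType} {V : normedModType R}
    (F : R -> set V) (a b : R) :
  a <= b -> convex_valued F ->
  (forall t, a <= t <= b -> exists w, \forall s \near t, F s w) ->
  exists2 v : R -> V, continuous v & forall t, a <= t <= b -> F t (v t).
Proof.
move=> ab F_convex F_local.
pose A : set R := [set s | a <= s <= b /\
  exists2 v : R -> V, continuous v & forall t, a <= t <= s -> F t (v t)].
have Aa : A a.
  split; first by rewrite lexx.
  have [|w /nbhs_singleton aw] := F_local a; first by rewrite lexx.
  exists (cst w); first exact: cst_continuous.
  by move=> t /le_anti <-.
have supA : has_sup A by split; [exists a | exists b => s [/andP[]]].
have ub := ub_le_sup (proj2 supA).
pose s := sup A.
have asb : a <= s <= b.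
  apply/andP; split; first exact: ub.
  by apply: ge_sup; [exists a | move=> x [/andP[]]].
have [w /nbhs_ballP[e /= e0 ew]] := F_local s asb.
have [s1 As1 s1s] := sup_adherent e0 supA; rewrite -/s in s1s.
have s1le : s1 <= s by exact: ub.
have [s1ab [v cv vF]] := As1.
(* On [p, s1], where both v and w are selections, the new field passes from v
   to w. *)
pose p := s - e.
pose c t := clamp ((t - p) / (s1 - p)).
have s1p : 0 < s1 - p by rewrite subr_gt0.
pose v' t := (1 - c t) *: v t + c t *: w.
have c01 t : 0 <= c t <= 1 by exact: clamp_itv.
have cc : continuous c.
  move=> t; apply: (@continuous_comp _ _ _ (fun t => (t - p) / (s1 - p)) clamp);
    last exact: continuous_clamp.
  apply: cvgM; last exact: cvg_cst.
  by apply: cvgB; [exact: cvg_id | exact: cvg_cst].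
have cv' : continuous v'.
  move=> t; apply: cvgD; apply: cvgZ; [|exact: cv|exact: cc|exact: cvg_cst].
  by apply: cvgB; [exact: cvg_cst | exact: cc].
have v'F t : a <= t -> t <= b -> t < s + e -> F t (v' t).
  move=> at_ tb te.
  have [tp|pt] := leP t p.
    have -> : v' t = v t.
      rewrite /v'; have -> : c t = 0; last by rewrite subr0 scale1r scale0r addr0.
      rewrite /c /clamp; apply/max_l; rewrite ge_min; apply/orP; right.
      by rewrite pmulr_lle0 ?invr_gt0// subr_le0.
    by apply: vF; rewrite at_ /=; apply: le_trans tp _; rewrite /p; lra.
  have Fw : F t w.
    by apply: ew; rewrite /ball /= ltr_distlC; move: pt; rewrite /p => ->.
  have [ts1|s1t] := leP t s1.
    by apply: F_convex => //; apply: vF; rewrite at_.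
  have -> : v' t = w; last by [].
  rewrite /v'; have -> : c t = 1; last by rewrite subrr scale0r scale1r add0r.
  rewrite /c /clamp min_l ?max_r//.
  by rewrite ler_pdivlMr// mul1r lerD2r ltW.
have /andP[a_s sb] := asb; suff <- : s = b.
  by exists v' => // t /andP[at_ ts]; apply: v'F => //; lra.
apply/le_anti; rewrite sb /=.
rewrite leNgt; apply/negP => s_lt_b.
pose r := Num.min b (s + e / 2).
have sr : s < r by rewrite lt_min s_lt_b; lra.
suff : r <= s by lra.
apply: ub; split; first by rewrite ge_min lexx /= andbT; lra.
exists v' => // t /andP[at_]; rewrite le_min => /andP[tb ts].
by apply: v'F => //; lra.
Qed.

(** * Consequences of continuous differentiability *)

Section C1.
Context {R : realType} {V : normedModType R} {f : V -> R}.
Hypothesis f_C1 : C1 f.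

(** The operator norm bounds the unit ball only; homogeneity does the rest. *)
Lemma C1_diff_near (x : V) (e : R) : 0 < e ->
  \forall y \near x, forall v, `|'d f y v - 'd f x v| <= e * `|v|.
Proof.
move=> e0; apply: filterS (proj2 f_C1 x e e0) => y yx v.
have d0 z : 'd f z 0 = 0 :> R by exact: linear0.
have dZ z (c : R) u : 'd f z (c *: u) = c * 'd f z u :> R by exact: linearZ.
have [->|v0] := eqVneq v 0; first by rewrite !d0 subr0 !normr0 mulr0.
have nv : 0 < `|v| by rewrite normr_gt0.
have le_e : (`|'d f y (`|v|^-1 *: v) - 'd f x (`|v|^-1 *: v)|%:E <= e%:E)%E.
  apply: le_trans yx; apply: ereal_sup_ubound.
  exists (`|v|^-1 *: v) => //=.
  by rewrite normrZ ger0_norm ?invr_ge0// mulVf// gt_eqF.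
move: le_e; rewrite lee_fin !dZ -mulrBr normrM.
by rewrite [X in X * _]ger0_norm ?invr_ge0// ler_pdivrMl// mulrC.
Qed.

Lemma C1_continuous : continuous f.
Proof. by move=> x; apply: differentiable_continuous; case: f_C1. Qed.

Lemma C1_diff_continuous : continuous (fun p : V * V => 'd f (p.1) p.2).
Proof.
case=> x w /=; apply/cvgrPdist_le => e e0.
have e1 : 0 < e / 2 / (`|w| + 1) by rewrite !divr_gt0// ltr_wpDl.
have dfx : 'd f x v @[v --> w] --> 'd f x w.
  by apply: diff_continuous; case: f_C1.
have e2 : 0 < e / 2 by rewrite divr_gt0.
near=> p.
have p1 : `|'d f (p.1) p.2 - 'd f x p.2| <= e / 2 / (`|w| + 1) * `|p.2|.
  suff : forall v, `|'d f (p.1) v - 'd f x v| <= e / 2 / (`|w| + 1) * `|v|.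
    exact.
  by near: p; exact: (cvg_fst (C1_diff_near x _ e1)).
have p2 : `|p.2| <= `|w| + 1.
  have : `|w - p.2| <= 1.
    near: p.
    have /cvgrPdist_le/(_ 1 ltr01) := @cvg_id _ (nbhs w).
    exact: cvg_snd.
  move=> wp; rewrite -[p.2](subrK w) (le_trans (ler_normD _ _))//.
  by rewrite addrC lerD2l distrC.
have p3 : `|'d f x w - 'd f x p.2| <= e / 2.
  by near: p; move/cvgrPdist_le : dfx => /(_ _ e2); exact: cvg_snd.
rewrite -[X in X - _](subrK ('d f x p.2)) -addrA (le_trans (ler_normD _ _))//.
rewrite [leRHS]splitr lerD// distrC (le_trans p1)//.
by rewrite -mulrA ler_piMr ?(ltW e2)// ler_pdivrMl ?mulr1// ltr_wpDl.
Unshelve. all: by end_near. Qed.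

Lemma differentiable_mvt (x y : V) : exists2 s, 0 <= s <= 1 &
  f y - f x = 'd f (x + s *: (y - x)) (y - x).
Proof.
pose l (s : R) : V := x + s *: (y - x).
have dl (s : R) : is_diff s l (fun h => h *: (y - x)).
  rewrite /l; apply: is_diff_eq; by rewrite add0r.
have df (s : R) : is_derive s (1 : R) (f \o l) ('d f (l s) (y - x)).
  have fls : differentiable f (l s) by case: f_C1.
  have ls : differentiable l s by [].
  split; first exact/derivable1_diffP/differentiable_comp.
  rewrite deriveE; last exact: differentiable_comp.
  by rewrite diff_comp//= diff_val scale1r.
have [s s01 sE] : exists2 s, s \in `[0, 1]%R &
    (f \o l) 1 - (f \o l) 0 = 'd f (l s) (y - x) * (1 - 0).
  apply: (@MVT_segment R _ (fun s => 'd f (l s) (y - x))) => //.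
  apply: continuous_subspaceT => s.
  by apply/differentiable_continuous/derivable1_diffP; have [] := df s.
exists s => //; move: sE.
by rewrite /l /= scale1r scale0r addr0 subr0 mulr1 subrKC => ->.
Qed.

(** The mean value theorem on segments of a ball where the differential is almost
    constant. *)
Lemma C1_strictly_differentiable (x : V) (e : R) : 0 < e ->
  \forall p \near (x, x),
    `|f p.1 - f p.2 - 'd f x (p.1 - p.2)| <= e * `|p.1 - p.2|.
Proof.
move=> e0; have /nbhs_ballP[r /= r0 rP] := C1_diff_near x _ e0.
exists (ball x r, ball x r).
  by split; exact: nbhsx_ballx.
case=> y z [/= xy xz].
have [s s01 ->] := differentiable_mvt z y.
apply: rP; move: xy xz; rewrite -!ball_normE /= => xy xz.
have -> : x - (z + s *: (y - z)) = (1 - s) *: (x - z) + s *: (x - y).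
  have -> : x - y = (x - z) - (y - z) by rewrite opprB addrA subrK.
  rewrite opprD addrA scalerBl scale1r [s *: (_ - (y - z))]scalerBr.
  by rewrite addrA subrK.
case/andP: s01 => s0 s1.
rewrite (le_lt_trans (ler_normD _ _))// !normrZ !ger0_norm ?subr_ge0//.
move: s1; rewrite le_eqVlt => /predU1P[->|s1].
  by rewrite subrr mul0r add0r mul1r.
have : (1 - s) * `|x - z| < (1 - s) * r by rewrite ltr_pM2l// subr_gt0.
have : s * `|x - y| <= s * r by rewrite ler_wpM2l// ltW.
lra.
Qed.

End C1.

(** * Retraction onto the constrained set *)

Definition tangent_proj {R : realType} {H E : normedModType R}
    (dot : {dot H for idfun}) (iota : {linear E -> H}) (x w : E * R) : E * R :=
  (w.1 - dot (iota x.1) (iota w.1) *: x.1, w.2).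

(** The difference quotient of the radial retraction along w: for x on the
    sphere, the first component of [x + h *: retraction_step dot iota h x w] is
    [x.1 + h *: w.1] divided by its H-norm n.  The coefficient subtracted in
    front of [x.1] is (1 - n^-1) / h, rewritten through the expansion of
    n ^+ 2 - 1 in powers of h so that it makes sense, and is continuous, at
    h = 0. *)
Definition retraction_step {R : realType} {H E : normedModType R}
    (dot : {dot H for idfun}) (iota : {linear E -> H}) (h : R) (x w : E * R) :
    E * R :=
  let n := `|iota (x.1 + h *: w.1)| in
  (n^-1 *: w.1 -
     ((2 * dot (iota x.1) (iota w.1) + h * `|iota w.1| ^+ 2) / (n * (1 + n)))
       *: x.1,
   w.2).

Definition push {R : realType} {H E : normedModType R}
    (dot : {dot H for idfun}) (iota : {linear E -> H}) (h : R) (x w : E * R) :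
    E * R :=
  x + h *: retraction_step dot iota h x w.

Section retraction.
Context {R : realType} {H E : normedModType R}.
Context {dot : {dot H for idfun}} {iota : {linear E -> H}}.
Hypothesis dot_norm : forall h : H, dot h h = `|h| ^+ 2.
Hypothesis iota_cont : continuous iota.

Lemma sqr_normD (g h : H) :
  `|g + h| ^+ 2 = `|g| ^+ 2 + 2 * dot g h + `|h| ^+ 2.
Proof.
rewrite -!dot_norm linearDl !linearDr /= (hermC dot h g) /= expr0 mul1r.
by ring.
Qed.

(** By polarization, the scalar product inherits continuity from the norm. *)
Lemma dot_cvg {T : Type} {F : set_system T} {FF : Filter F} (f g : T -> H)
    (a b : H) : f @ F --> a -> g @ F --> b ->
  dot (f t) (g t) @[t --> F] --> dot a b.
Proof.
move=> fa gb.
have polar c d : dot c d = 2^-1 * (`|c + d| ^+ 2 - `|c| ^+ 2 - `|d| ^+ 2).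
  by rewrite sqr_normD; field.
rewrite polar; under eq_fun do rewrite polar.
have sqr_cvg (k : T -> H) c : k @ F --> c ->
    `|k t| ^+ 2 @[t --> F] --> `|c| ^+ 2.
  move=> kc; rewrite expr2; under eq_fun do rewrite expr2.
  by apply: cvgM; exact: cvg_norm.
apply: cvgM; first exact: cvg_cst.
by apply: cvgB; [apply: cvgB|]; apply: sqr_cvg => //; exact: cvgD.
Qed.

Lemma tangent_proj_id x w :
  tangent dot iota x w -> tangent_proj dot iota x w = w.
Proof.
by rewrite /tangent_proj => ->; rewrite scale0r subr0 -surjective_pairing.
Qed.

Lemma tangent_proj0 x : tangent_proj dot iota x 0 = 0.
Proof. by rewrite /tangent_proj /= linear0 linear0r scale0r subr0. Qed.

Lemma tangent_proj_convex x v w (c : R) :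
  tangent_proj dot iota x ((1 - c) *: v + c *: w) =
  (1 - c) *: tangent_proj dot iota x v + c *: tangent_proj dot iota x w.
Proof.
rewrite /tangent_proj; congr (_, _) => /=.
rewrite !linearD !linearZ /= !scalerA addrACA -scalerDl.
by congr (_ + _ *: _); congr (_ + _); exact: mulrC.
Qed.

Lemma retraction_step0 x w : sphereR iota x ->
  retraction_step dot iota 0 x w = tangent_proj dot iota x w.
Proof.
move=> [/= x1 _]; rewrite /retraction_step scale0r addr0 x1 invr1 scale1r.
rewrite mul0r addr0 mul1r.
by rewrite /tangent_proj; congr (_ - _ *: _, _); field.
Qed.

Lemma push_sphere h x w : sphereR iota x -> iota (x.1 + h *: w.1) != 0 ->
  sphereR iota (push dot iota h x w).
Proof.
move=> [/= x1 _]; rewrite -normr_gt0.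
set n := `|_| => n0; split => //=; rewrite /sphere /=.
have nE : n ^+ 2 =
    1 + h * (2 * dot (iota x.1) (iota w.1) + h * `|iota w.1| ^+ 2).
  rewrite /n linearD linearZ /= sqr_normD x1 linearZr_LR /= normrZ exprMn.
  by rewrite real_normK ?num_real//; ring.
pose k := 2 * dot (iota x.1) (iota w.1) + h * `|iota w.1| ^+ 2.
rewrite -/k in nE.
suff -> : x.1 + h *: (retraction_step dot iota h x w).1 =
    n^-1 *: (x.1 + h *: w.1).
  by rewrite linearZ /= normrZ ger0_norm ?invr_ge0 ?ltW// mulVf// gt_eqF.
rewrite /retraction_step -/n -/k /=.
have hk : h * (k / (n * (1 + n))) = 1 - n^-1.
  have -> : h * (k / (n * (1 + n))) = (n ^+ 2 - 1) / (n * (1 + n)).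
    by rewrite nE mulrA; congr (_ / _); ring.
  by field; rewrite gt_eqF//= gt_eqF// addr_gt0.
rewrite scalerBr scalerA [X in _ - X]scalerA hk scalerDr [in RHS]scalerA.
rewrite scalerBl.
by rewrite scale1r [h * _]mulrC opprB addrC addrA addrNK addrC.
Qed.

Lemma push0 h x : push dot iota h x 0 = x.
Proof.
rewrite /push /retraction_step /=.
rewrite !linear0 normr0 expr0n !mulr0 addr0 mul0r scale0r !subr0.
by rewrite -[(0, 0)]/(0 : E * R) scaler0 addr0.
Qed.

Section cvg.
Context {T : Type} {F : set_system T} {FF : Filter F}.
Context {h_ : T -> R} {x_ w_ : T -> E * R} {h : R} {x w : E * R}.
Hypotheses (h_h : h_ @ F --> h) (x_x : x_ @ F --> x) (w_w : w_ @ F --> w).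

Let x1 : (x_ t).1 @[t --> F] --> x.1. Proof. exact: cvg_comp x_x cvg_fst. Qed.
Let w1 : (w_ t).1 @[t --> F] --> w.1. Proof. exact: cvg_comp w_w cvg_fst. Qed.
Let w2 : (w_ t).2 @[t --> F] --> w.2. Proof. exact: cvg_comp w_w cvg_snd. Qed.
Let ix : iota (x_ t).1 @[t --> F] --> iota x.1.
Proof. exact: cvg_comp x1 (iota_cont _). Qed.
Let iw : iota (w_ t).1 @[t --> F] --> iota w.1.
Proof. exact: cvg_comp w1 (iota_cont _). Qed.

Lemma tangent_proj_cvg :
  tangent_proj dot iota (x_ t) (w_ t) @[t --> F] --> tangent_proj dot iota x w.
Proof.
apply: (@cvg_pair _ _ _ F (nbhs _) (nbhs _)) => //.
by apply: cvgB => //; apply: cvgZ => //; exact: dot_cvg.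
Qed.

Lemma iota_line_cvg : iota ((x_ t).1 + h_ t *: (w_ t).1) @[t --> F] -->
  iota (x.1 + h *: w.1).
Proof.
apply: (@cvg_comp _ _ _ _ (iota : E -> H) _ _ _ _ (iota_cont _)).
by apply: cvgD => //; exact: cvgZ.
Qed.

Lemma retraction_step_cvg : iota (x.1 + h *: w.1) != 0 ->
  retraction_step dot iota (h_ t) (x_ t) (w_ t) @[t --> F] -->
    retraction_step dot iota h x w.
Proof.
move=> n0; have ncvg : `|iota ((x_ t).1 + h_ t *: (w_ t).1)| @[t --> F] -->
    `|iota (x.1 + h *: w.1)| by apply: cvg_norm; exact: iota_line_cvg.
rewrite -normr_gt0 in n0.
apply: (@cvg_pair _ _ _ F (nbhs _) (nbhs _)) => //.
apply: cvgB; apply: cvgZ => //.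
  by apply: cvgV => //; rewrite gt_eqF.
apply: cvgM; first apply: cvgD; last apply: cvgV.
- by apply: cvgM; [exact: cvg_cst | exact: dot_cvg].
- apply: cvgM => //; rewrite expr2; under eq_fun do rewrite expr2.
  by apply: cvgM; exact: cvg_norm.
- by rewrite gt_eqF// mulr_gt0// addr_gt0.
- by apply: cvgM => //; apply: cvgD => //; exact: cvg_cst.
Qed.

Lemma push_cvg : iota (x.1 + h *: w.1) != 0 ->
  push dot iota (h_ t) (x_ t) (w_ t) @[t --> F] --> push dot iota h x w.
Proof.
by move=> n0; apply: cvgD => //; apply: cvgZ => //; exact: retraction_step_cvg.
Qed.

End cvg.
End retraction.

(** * Uniform limits of paths in the product *)

Lemma cvg_of_rate {R : realType} {V : completeNormedModType R} (a : nat -> V)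
    (r : nat -> R) : r @ \oo --> 0 ->
  (forall n m, (n <= m)%N -> `|a n - a m| <= r n) -> cvg (a @ \oo).
Proof.
move=> r0 ar; apply/cauchy_cvgP/cauchy_exP => e e0.
have /cvgrPdist_lt/(_ e e0) [n _ nr] := r0.
exists (a n), n => // m nm /=; rewrite -ball_normE /=.
rewrite (le_lt_trans (ar _ _ nm))//; have := nr n (leqnn n).
by rewrite sub0r normrN; apply: le_lt_trans; exact: ler_norm.
Qed.

(** The limit exists pointwise by completeness of the two factors of E * R. *)
Lemma uniform_rate_limit {R : realType} {T : topologicalType}
    {E : completeNormedModType R} (u : nat -> T -> E * R) (r : nat -> R) :
  r @ \oo --> 0 -> (forall n, continuous (u n)) ->
  (forall n m, (n <= m)%N -> forall t, `|u n t - u m t| <= r n) ->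
  exists2 g, continuous g & forall t, u n t @[n --> \oo] --> g t.
Proof.
move=> r0 u_cont ur.
have cvg_u t : exists p : E * R, u n t @[n --> \oo] --> p.
  have cvg1 : cvg ((u n t).1 @[n --> \oo]).
    apply: (cvg_of_rate _ _ r0) => n m /ur /(_ t); apply: le_trans.
    by rewrite [leRHS]prod_normE le_max lexx.
  have cvg2 : cvg ((u n t).2 @[n --> \oo]).
    apply: (cvg_of_rate _ _ r0) => n m /ur /(_ t); apply: le_trans.
    by rewrite [leRHS]prod_normE le_max lexx orbT.
  exists (lim ((u n t).1 @[n --> \oo]), lim ((u n t).2 @[n --> \oo])).
  have -> : (fun n => u n t) = (fun n => ((u n t).1, (u n t).2)).
    by apply/funext => n; exact: surjective_pairing.
  exact: (@cvg_pair _ _ _ \oo (nbhs _) (nbhs _)).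
have [g ug] := choice cvg_u; exists g => //.
have gu n t : `|u n t - g t| <= r n.
  have : `|u n t - u m t| @[m --> \oo] --> `|u n t - g t|.
    by apply: cvg_norm; apply: cvgB; [exact: cvg_cst | exact: ug].
  move=> lim_m; rewrite -(cvg_lim (@Rhausdorff R) lim_m); apply: limr_le.
    exact: cvgP lim_m.
  by exists n => // m nm; exact: ur.
move=> t; apply/cvgrPdist_le => e e0.
have e3 : 0 < e / 3 by rewrite divr_gt0.
have /cvgrPdist_lt/(_ _ e3) [n _ /(_ n (leqnn n))] := r0.
rewrite sub0r normrN => /(le_lt_trans (ler_norm _)) rn.
have /cvgrPdist_le/(_ _ e3) := u_cont n t.
apply: filterS => s us.
have -> : g t - g s = - (u n t - g t) + (u n t - u n s) + (u n s - g s).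
  by rewrite opprB !subrKA.
have := ler_normD (- (u n t - g t) + (u n t - u n s)) (u n s - g s).
have := ler_normD (- (u n t - g t)) (u n t - u n s).
rewrite normrN; have := gu n t; have := gu n s.
lra.
Qed.

(** * Paths on the constrained set *)

(** Being constant beyond 0 and 1 lets the whole line stand for [0, 1] in
    suprema and uniform distances. *)
Definition sphere_path {R : realType} {H E : normedModType R}
    (iota : {linear E -> H}) (p0 p1 : E * R) (g : R -> E * R) : Prop :=
  [/\ continuous g, (forall t, sphereR iota (g t)),
      (forall t, g (clamp t) = g t), g 0 = p0 & g 1 = p1].

Definition path_max {R : realType} {E : normedModType R} (phi : E * R -> R)
    (g : R -> E * R) : R := sup (range (phi \o g)).

(** The order of Ekeland's principle, for the uniform distance between paths. *)
Definition below {R : realType} {E : normedModType R} (phi : E * R -> R)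
    (k : R) (g' g : R -> E * R) : Prop :=
  forall t, k * `|g' t - g t| <= path_max phi g - path_max phi g'.

Section sphere_paths.
Context {R : realType} {H E : completeNormedModType R}.
Context {dot : {dot H for idfun}} {iota : {linear E -> H}}.
Hypothesis dot_norm : forall h : H, dot h h = `|h| ^+ 2.
Hypothesis iota_cont : continuous iota.
Context {phi : E * R -> R}.
Hypothesis phi_C1 : C1 phi.
Context {p0 p1 : E * R}.

Lemma path_max_attained g : sphere_path iota p0 p1 g ->
  exists2 t, 0 <= t <= 1 & path_max phi g = phi (g t) /\
    forall s, phi (g s) <= phi (g t).
Proof.
move=> [g_cont _ g_clamp _ _].
have cphig : {within `[0, 1], continuous (phi \o g)}.
  apply: continuous_subspaceT => t.
  by apply: continuous_comp; [exact: g_cont | exact: C1_continuous].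
have [t t01 tmax] := EVT_max ler01 cphig.
have tmax' s : phi (g s) <= phi (g t).
  by rewrite -(g_clamp s); apply: tmax; rewrite in_itv /= clamp_itv.
exists t; first by rewrite in_itv in t01.
split=> //; apply/le_anti/andP; split.
  by apply: ge_sup; [exists (phi (g t)), t | move=> _ [s _ <-]; exact: tmax'].
apply: ub_le_sup; last by exists t.
by exists (phi (g t)) => _ [s _ <-]; exact: tmax'.
Qed.

Lemma le_path_max g t : sphere_path iota p0 p1 g -> phi (g t) <= path_max phi g.
Proof. by move=> /path_max_attained[s _ [-> ]]. Qed.

Lemma path_max_le g M : sphere_path iota p0 p1 g ->
  (forall t, phi (g t) <= M) -> path_max phi g <= M.
Proof. by move=> /path_max_attained[s _ [-> _]]. Qed.

(** * Decreasing the maximum along a path *)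

(** The three conditions on the field are convex, because the projection is
    linear in the direction, and hold around t for a constant direction: a steep
    one at levels >= c, and 0 below c.  The two choices are compatible at the
    levels between b and c, where nothing is prescribed but the norm. *)
Lemma descent_field g (b c k : R) : sphere_path iota p0 p1 g -> b < c ->
  (forall t, c <= phi (g t) -> exists y,
     [/\ tangent dot iota (g t) y, `|y| <= 1 & 'd phi (g t) y < - (4 * k)]) ->
  exists2 v : R -> E * R, continuous v & forall t,
    [/\ v (clamp t) = v t,
        phi (g t) <= b -> v t = 0,
        `|tangent_proj dot iota (g t) (v t)| < 2 &
        c <= phi (g t) ->
          'd phi (g t) (tangent_proj dot iota (g t) (v t)) < - (4 * k)].
Proof.
move=> [g_cont g_sphere g_clamp _ _] bc steep.
pose P := tangent_proj dot iota.
pose F t : set (E * R) := [set w | [/\ phi (g t) <= b -> w = 0,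
  `|P (g t) w| < 2 & c <= phi (g t) -> 'd phi (g t) (P (g t) w) < - (4 * k)]].
have cphig : continuous (phi \o g).
  by move=> t; apply: continuous_comp; [exact: g_cont | exact: C1_continuous].
have F_convex : convex_valued F.
  move=> t v w s s01 [v0 v2 vk] [w0 w2 wk].
  split=> [tb||tc]; rewrite ?/P ?tangent_proj_convex.
  - by rewrite v0// w0// !scaler0 addr0.
  - rewrite (le_lt_trans (ler_normD _ _))// !normrZ.
    case/andP: (s01) => s0 s1; rewrite !ger0_norm ?subr_ge0//.
    exact: lt_convex.
  - have lin x y : 'd phi (g t) ((1 - s) *: x + s *: y) =
        (1 - s) * 'd phi (g t) x + s * 'd phi (g t) y :> R.
      by rewrite [LHS]linearD; congr (_ + _); exact: linearZ.
    by rewrite lin; apply: lt_convex => //; [exact: vk | exact: wk].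
have F_local (t : R) : 0 <= t <= 1 -> exists w, \forall s \near t, F s w.
  move=> _; have [ct|tc] := leP c (phi (g t)).
    have [y [y_tan y1 yk]] := steep t ct; exists y.
    have Py : P (g s) y @[s --> t] --> y.
      rewrite -[X in _ --> X](tangent_proj_id _ _ y_tan).
      by apply: tangent_proj_cvg => //; [exact: g_cont | exact: cvg_cst].
    have near_b : \forall s \near t, b < phi (g s).
      by apply: (cvgr_gt _ (cphig t)); exact: lt_le_trans bc ct.
    have near_2 : \forall s \near t, `|P (g s) y| < 2.
      apply: (cvgr_lt _ (cvg_norm Py)); lra.
    have near_k : \forall s \near t, 'd phi (g s) (P (g s) y) < - (4 * k).
      have gP : (g s, P (g s) y) @[s --> t] --> (g t, y).
        by apply: (@cvg_pair _ _ _ _ (nbhs _) (nbhs _)) => //; exact: g_cont.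
      have dP : 'd phi (g s) (P (g s) y) @[s --> t] --> ('d phi (g t) y : R).
        exact: (cvg_comp _ _ gP (C1_diff_continuous phi_C1 _)).
      exact: (cvgr_lt _ dP).
    near=> s; split=> [sb|//|_].
    - by exfalso; move: sb; apply/negP; rewrite -ltNge; near: s.
    - by near: s.
    - by near: s.
  exists 0; have : \forall s \near t, phi (g s) < c.
    exact: (cvgr_lt _ (cphig t)).
  apply: filterS => s sc; split=> // [|cs].
    by rewrite /P tangent_proj0 normr0.
  by move: cs; rewrite leNgt sc.
have [v v_cont vF] := continuous_selection F 0 1 ler01 F_convex F_local.
exists (v \o clamp).
  by move=> t; apply: continuous_comp; [exact: continuous_clamp | exact: v_cont].
move=> t; have := vF (clamp t) (clamp_itv t).
by rewrite /F /= clampK g_clamp => -[].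
Unshelve. all: by end_near. Qed.

(** At levels >= c, strict differentiability transfers the rate of decrease at
    [g t] to the short chords issued from the nearby points of g.  Below c, the
    moved points stay below c, hence below the maximum reduced by a small
    amount. *)
Lemma descent_near g (v : R -> E * R) (c k t : R) : 0 < k ->
  sphere_path iota p0 p1 g -> continuous v -> c < path_max phi g ->
  `|tangent_proj dot iota (g t) (v t)| < 2 ->
  (c <= phi (g t) ->
    'd phi (g t) (tangent_proj dot iota (g t) (v t)) < - (4 * k)) ->
  \forall t' \near t & h \near 0^'+,
    [/\ iota ((g t').1 + h *: (v t').1) != 0,
        `|retraction_step dot iota h (g t') (v t')| <= 2 &
        phi (push dot iota h (g t') (v t')) <= path_max phi g - h * (2 * k)].
Proof.
move=> k0 g_path v_cont c_max P2 Pk.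
have [g_cont g_sphere _ _ _] := g_path.
pose s h t := retraction_step dot iota h (g t) (v t).
pose nz h t := iota ((g t).1 + h *: (v t).1) != 0.
pose gh h t := push dot iota h (g t) (v t).
have nz0 : nz 0 t.
  rewrite /nz scale0r addr0 -normr_gt0.
  by have [/= -> _] := g_sphere t.
have h_0 : h @[h --> (0 : R)^'+] --> (0 : R) by exact: cvg_within.
have G_h : z.2 @[z --> (nbhs t, (0 : R)^'+)] --> (0 : R).
  exact: (cvg_comp _ _ cvg_snd h_0).
have G_g : g z.1 @[z --> (nbhs t, (0 : R)^'+)] --> g t.
  have gt : g t' @[t' --> t] --> g t by exact: g_cont.
  exact: (cvg_comp _ _ cvg_fst gt).
have G_v : v z.1 @[z --> (nbhs t, (0 : R)^'+)] --> v t.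
  have vt : v t' @[t' --> t] --> v t by exact: v_cont.
  exact: (cvg_comp _ _ cvg_fst vt).
have G_s : s z.2 z.1 @[z --> (nbhs t, (0 : R)^'+)] --> s 0 t.
  exact: retraction_step_cvg.
have sE : s 0 t = tangent_proj dot iota (g t) (v t) by exact: retraction_step0.
have G_gh : gh z.2 z.1 @[z --> (nbhs t, (0 : R)^'+)] --> g t.
  rewrite -[X in _ --> X]addr0 -[X in _ + X](scale0r (s 0 t)).
  by apply: cvgD => //; exact: cvgZ.
have near_nz : \forall z \near (nbhs t, (0 : R)^'+), nz z.2 z.1.
  have n0 : 0 < `|iota ((g t).1 + 0 *: (v t).1)| by rewrite normr_gt0.
  near=> z; rewrite /nz -normr_gt0; near: z.
  exact: (cvgr_gt _ (cvg_norm (iota_line_cvg iota_cont G_h G_g G_v))).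
have near_2 : \forall z \near (nbhs t, (0 : R)^'+), `|s z.2 z.1| < 2.
  by apply: (cvgr_lt _ (cvg_norm G_s)); rewrite sE.
have near_0 : \forall z \near (nbhs t, (0 : R)^'+), 0 < z.2.
  exact: (cvg_snd (nbhs_right_gt _)).
suff : \forall z \near (nbhs t, (0 : R)^'+),
    phi (gh z.2 z.1) <= path_max phi g - z.2 * (2 * k).
  move=> near_phi.
  by near=> z; split; [|apply/ltW|]; near: z.
have [ct|tc] := leP c (phi (g t)).
- have near_s : \forall z \near (nbhs t, (0 : R)^'+),
      'd phi (g t) (s z.2 z.1) < - (4 * k).
    have ds : 'd phi (g t) (s z.2 z.1) @[z --> (nbhs t, (0 : R)^'+)] -->
        ('d phi (g t) (s 0 t) : R).
      by apply: (cvg_comp _ _ G_s); apply: diff_continuous; case: phi_C1.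
    by apply: (cvgr_lt _ ds); rewrite sE; exact: Pk.
  have G_pair : (gh z.2 z.1, g z.1) @[z --> (nbhs t, (0 : R)^'+)] -->
      (g t, g t).
    exact: (@cvg_pair _ _ _ _ (nbhs _) (nbhs _)).
  have near_d := G_pair _ (C1_strictly_differentiable phi_C1 (g t) k k0).
  near=> z.
  have zd : `|phi (gh z.2 z.1) - phi (g z.1) -
      'd phi (g t) (gh z.2 z.1 - g z.1)| <= k * `|gh z.2 z.1 - g z.1|.
    by near: z.
  have zs : 'd phi (g t) (s z.2 z.1) < - (4 * k) by near: z.
  have z2 : `|s z.2 z.1| < 2 by near: z.
  have z0 : 0 < z.2 by near: z.
  have ghE : gh z.2 z.1 - g z.1 = z.2 *: s z.2 z.1.
    by rewrite /gh /push addrC addKr.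
  have dE : 'd phi (g t) (z.2 *: s z.2 z.1) =
      z.2 * 'd phi (g t) (s z.2 z.1) :> R.
    exact: linearZ.
  move: zd; rewrite ghE dE normrZ gtr0_norm// => /(le_trans (ler_norm _)).
  have : z.2 * 'd phi (g t) (s z.2 z.1) <= z.2 * (- (4 * k)).
    by rewrite ler_wpM2l// ltW.
  have : k * (z.2 * `|s z.2 z.1|) <= k * (z.2 * 2).
    by rewrite ler_wpM2l ?ler_wpM2l// ltW.
  have := le_path_max g z.1 g_path.
  lra.
- have phi_gh : phi (gh z.2 z.1) @[z --> (nbhs t, (0 : R)^'+)] --> phi (g t).
    exact: (cvg_comp _ _ G_gh (C1_continuous phi_C1 _)).
  have bound : path_max phi g - z.2 * (2 * k) @[z --> (nbhs t, (0 : R)^'+)] -->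
      path_max phi g - 0 * (2 * k).
    apply: cvgB; first exact: cvg_cst.
    by apply: cvgM => //; exact: cvg_cst.
  rewrite mul0r subr0 in bound.
  near=> z; apply: (@le_trans _ _ c); apply: ltW; near: z.
  + exact: (cvgr_lt _ phi_gh).
  + exact: (cvgr_gt _ bound).
Unshelve. all: by end_near. Qed.

(** Compactness of [0, 1] turns the local times of [descent_near] into a single
    one.  The bound b that separates the endpoints from the steep part of g is
    the larger of the two endpoint levels, so that the field vanishes there. *)
Lemma descent g (c k : R) : 0 < k -> sphere_path iota p0 p1 g ->
  phi p0 < c -> phi p1 < c -> c < path_max phi g ->
  (forall t, c <= phi (g t) -> exists y,
     [/\ tangent dot iota (g t) y, `|y| <= 1 & 'd phi (g t) y < - (4 * k)]) ->
  exists g' h, [/\ 0 < h, sphere_path iota p0 p1 g',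
    (forall t, `|g' t - g t| <= h * 2) &
    path_max phi g' <= path_max phi g - h * (2 * k)].
Proof.
move=> k0 g_path p0c p1c c_max steep.
have bc : Num.max (phi p0) (phi p1) < c by rewrite gt_max p0c p1c.
have [v v_cont vP] := descent_field g _ c k g_path bc steep.
have [g_cont g_sphere g_clamp g0 g1] := g_path.
pose gh h t := push dot iota h (g t) (v t).
pose good h t := [/\ iota ((g t).1 + h *: (v t).1) != 0,
  `|retraction_step dot iota h (g t) (v t)| <= 2 &
  phi (gh h t) <= path_max phi g - h * (2 * k)].
have good_all : \forall h \near (0 : R)^'+, `[0, 1] `<=` good h.
  have /compact_near_coveringP := @segment_compact R 0 1.
  apply => t _; have [_ _ P2 Pk] := vP t.
  exact: (descent_near _ _ _ _ _ k0 g_path v_cont c_max P2 Pk).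
have [h [h_good h0]] : exists h, (`[0, 1] `<=` good h) /\ 0 < h.
  apply: (@filter_ex _ ((0 : R)^'+)); near=> h; split; first by near: h.
  by near: h; exact: nbhs_right_gt.
have good_h t : good h t.
  have := h_good (clamp t); rewrite /= in_itv /= clamp_itv => /(_ isT).
  by rewrite /good /gh g_clamp; have [-> _ _ _] := vP t.
have s_end t : phi (g t) <= Num.max (phi p0) (phi p1) -> gh h t = g t.
  by have [_ v0 _ _] := vP t; move=> /v0 vt; rewrite /gh vt push0.
have gh_path : sphere_path iota p0 p1 (gh h).
  split.
  - move=> t; apply: push_cvg; [exact: dot_norm|exact: iota_cont|
      exact: cvg_cst|exact: g_cont|exact: v_cont|].
    by have [] := good_h t.
  - by move=> t; apply: push_sphere => //; have [] := good_h t.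
  - by move=> t; rewrite /gh g_clamp; have [-> _ _ _] := vP t.
  - by rewrite s_end// g0 le_max lexx.
  - by rewrite s_end// g1 le_max lexx orbT.
exists (gh h), h; split=> //.
  move=> t; rewrite /gh /push addrC addKr normrZ gtr0_norm//.
  rewrite ler_wpM2l ?(ltW h0)//.
  by have [] := good_h t.
by apply: (path_max_le _ _ gh_path) => t; have [] := good_h t.
Unshelve. all: by end_near. Qed.

(** * The variational principle for paths *)

(** A sequence decreasing for the order is uniformly Cauchy, because k times
    its increments are bounded by those of the convergent sequence of maxima. *)
Lemma below_lower_bound (k A : R) (u : nat -> R -> E * R) : 0 < k ->
  (forall n, sphere_path iota p0 p1 (u n)) ->
  (forall n, A <= path_max phi (u n)) ->
  (forall n, below phi k (u n.+1) (u n)) ->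
  exists2 g, sphere_path iota p0 p1 g & forall n, below phi k g (u n).
Proof.
move=> k0 u_path uA u_desc.
have desc n m : (n <= m)%N -> below phi k (u m) (u n).
  move=> /subnKC <-; elim: (m - n)%N => [|j IH] t.
    by rewrite addn0 !subrr normr0 mulr0.
  have := u_desc (n + j)%N t; have := IH t; rewrite addnS.
  have := ler_distD (u (n + j)%N t) (u (n + j).+1 t) (u n t).
  rewrite -(ler_pM2l k0) mulrDr; lra.
pose I n := path_max phi (u n).
have I_mono : {homo I : n m / (n <= m)%N >-> m <= n}.
  move=> n m nm; rewrite -subr_ge0; apply: le_trans (desc n m nm 0).
  by rewrite mulr_ge0// ltW.
have I_cvg : cvgn I.
  by apply: nonincreasing_is_cvgn => //; exists A => _ [n _ <-]; exact: uA.
have I_lim n : limn I <= I n by exact: nonincreasing_cvgn_ge.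
have rate0 : k^-1 * (I n - limn I) @[n --> \oo] --> 0.
  rewrite -(mulr0 k^-1) -(subrr (limn I)); apply: cvgM; first exact: cvg_cst.
  by apply: cvgB; [exact: I_cvg | exact: cvg_cst].
have rate n m : (n <= m)%N -> forall t,
    `|u n t - u m t| <= k^-1 * (I n - limn I).
  move=> nm t; rewrite ler_pdivlMl// distrC; apply: le_trans (desc n m nm t) _.
  by rewrite lerD2l lerN2; exact: I_lim.
have [|g g_cont ug] := uniform_rate_limit u _ rate0 _ rate.
  by move=> n; have [] := u_path n.
have g_path : sphere_path iota p0 p1 g.
  have stay t p : (forall n, u n t = p) -> g t = p.
    move=> utp; apply: (cvg_unique _ (ug t)); first exact: norm_hausdorff.
    have -> : (fun n => u n t) = cst p by exact/funext.
    exact: cvg_cst.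
  split => //.
  - move=> t; split=> //=.
    have ng : `|iota (u n t).1| @[n --> \oo] --> `|iota (g t).1|.
      have ug1 : (u n t).1 @[n --> \oo] --> (g t).1.
        exact: (cvg_comp _ _ (ug t) cvg_fst).
      by apply: cvg_norm; exact: (cvg_comp _ _ ug1 (iota_cont _)).
    apply: (cvg_unique _ ng); first exact: norm_hausdorff.
    have -> : (fun n => `|iota (u n t).1|) = cst 1.
      by apply/funext => n; have [_ /(_ t) [+ _] _ _ _] := u_path n.
    exact: cvg_cst.
  - move=> t; apply: (cvg_unique _ (ug _)); first exact: norm_hausdorff.
    have -> : (fun n => u n (clamp t)) = (fun n => u n t).
      by apply/funext => n; have [_ _ -> _ _] := u_path n.
    exact: ug.
  - by apply: stay => n; have [] := u_path n.
  - by apply: stay => n; have [] := u_path n.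
have g_le n : path_max phi g <= I n.
  apply: (path_max_le _ _ g_path) => t.
  have phi_u : phi (u m t) @[m --> \oo] --> phi (g t).
    exact: (cvg_comp _ _ (ug t) (C1_continuous phi_C1 _)).
  rewrite -(cvg_lim (@Rhausdorff R) phi_u); apply: limr_le.
    exact: cvgP phi_u.
  exists n => // m nm; apply: le_trans (I_mono _ _ nm).
  exact: (le_path_max _ _ (u_path m)).
exists g => // n t.
have d_cvg : k * `|u m t - u n t| @[m --> \oo] --> k * `|g t - u n t|.
  apply: cvgM; first exact: cvg_cst.
  by apply: cvg_norm; apply: cvgB; [exact: ug | exact: cvg_cst].
rewrite -(cvg_lim (@Rhausdorff R) d_cvg); apply: limr_le.
  exact: cvgP d_cvg.
exists n => // m nm; apply: le_trans (desc n m nm t) _.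
by rewrite lerD2l lerN2; exact: g_le.
Qed.

Lemma ekeland_path (k A : R) (g : R -> E * R) : 0 < k ->
  (forall g, sphere_path iota p0 p1 g -> A <= path_max phi g) ->
  sphere_path iota p0 p1 g ->
  exists2 g', sphere_path iota p0 p1 g' /\ below phi k g' g &
    forall g'', sphere_path iota p0 p1 g'' -> below phi k g'' g' ->
      path_max phi g' <= path_max phi g''.
Proof.
move=> k0 A_le g_path.
pose le (x y : {g | sphere_path iota p0 p1 g}) := below phi k (sval x) (sval y).
have [|||||[g' g'_arc] g'g g'_min] := @brezis_browder R _ le
  (fun x => path_max phi (sval x)) A _ _ _ _ _ (exist _ g g_path).
- by move=> x t; rewrite !subrr normr0 mulr0.
- move=> y x z xy yz t; have := xy t; have := yz t.
  have := ler_distD (sval y t) (sval x t) (sval z t).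
  rewrite -(ler_pM2l k0) mulrDr; lra.
- move=> x y xy; rewrite -subr_ge0; apply: le_trans (xy 0).
  by rewrite mulr_ge0// ltW.
- by move=> [x x_path]; exact: A_le.
- move=> u u_desc.
  have [|n|x x_path xu] :=
    @below_lower_bound k A (fun n => sval (u n)) k0 _ _ u_desc.
  + by move=> n; exact: svalP.
  + by apply: A_le; exact: svalP.
  by exists (exist _ x x_path).
exists g'; first by split.
by move=> g'' g''_arc; apply: (g'_min (exist _ g'' g''_arc)).
Qed.

End sphere_paths.

(** * The minimax principle *)

Lemma norm_le_prod_norm (R : realType) (E : normedModType R) (y : E * R) :
  `|y| <= prod_norm y.
Proof.
rewrite /prod_norm [leLHS]prod_normE ge_max; apply/andP; split => /=.
  rewrite -[leLHS]ger0_norm// -sqrtr_sqr ler_wsqrtr// lerDl.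
  exact: sqr_ge0.
by rewrite -sqrtr_sqr ler_wsqrtr// lerDr sqr_ge0.
Qed.

Lemma prod_norm_le (R : realType) (E : normedModType R) (y : E * R) :
  prod_norm y <= 2 * `|y|.
Proof.
have y0 : 0 <= 2 * `|y| by rewrite mulr_ge0.
rewrite -[leRHS]ger0_norm// -sqrtr_sqr ler_wsqrtr// exprMn.
have y1 : `|y.1| ^+ 2 <= `|y| ^+ 2.
  by rewrite ler_sqr ?nnegrE// [leRHS]prod_normE le_max lexx.
have y2 : y.2 ^+ 2 <= `|y| ^+ 2.
  rewrite -[leLHS]real_normK ?num_real//.
  by rewrite ler_sqr ?nnegrE// [leRHS]prod_normE le_max lexx orbT.
have := sqr_ge0 `|y|; lra.
Qed.

Lemma sphere_minimax {R : realType} {H E : completeNormedModType R}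
    {dot : {dot H for idfun}} {iota : {linear E -> H}}
    (dot_norm : forall h : H, dot h h = `|h| ^+ 2) (iota_cont : continuous iota)
    {phi : E * R -> R} (phi_C1 : C1 phi) {p0 p1 : E * R} (A eps delta : R)
    (g0 : R -> E * R) :
  0 < eps -> 0 < delta ->
  (forall g, sphere_path iota p0 p1 g -> A <= path_max phi g) ->
  sphere_path iota p0 p1 g0 -> path_max phi g0 <= A + eps ->
  phi p0 < A - 2 * eps -> phi p1 < A - 2 * eps ->
  exists x, [/\ sphereR iota x, A - 2 * eps <= phi x <= A + eps,
    exists2 t, 0 <= t <= 1 & `|x - g0 t| <= delta &
    forall y, tangent dot iota x y -> `|y| <= 1 ->
      `|'d phi x y| <= 4 * (eps / delta)].
Proof.
move=> e0 d0 A_le g0_path g0_max p0A p1A.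
have k0 : 0 < eps / delta by rewrite divr_gt0.
have [g [g_path g_below] g_min] :=
  ekeland_path iota_cont phi_C1 _ A g0 k0 A_le g0_path.
have gA := A_le g g_path.
have g_max : path_max phi g <= path_max phi g0.
  by rewrite -subr_ge0; apply: le_trans (g_below 0); rewrite mulr_ge0// ltW.
have g_dist t : `|g t - g0 t| <= delta.
  rewrite -(ler_pM2l k0); apply: le_trans (g_below t) _.
  by rewrite divfK ?gt_eqF//; lra.
have [_ g_sphere g_clamp _ _] := g_path.
apply: contrapT => no_x.
have steep t : A - 2 * eps <= phi (g t) -> exists y,
    [/\ tangent dot iota (g t) y, `|y| <= 1 & 'd phi (g t) y < - (4 * (eps / delta))].
  move=> gtA; apply: contrapT => no_y; apply: no_x; exists (g t); split => //.
  - rewrite gtA; apply: le_trans g0_max; apply: le_trans g_max.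
    exact: (le_path_max phi_C1 _ _ g_path).
  - by exists (clamp t); [exact: clamp_itv | rewrite -(g_clamp t) g_dist].
  have bound y : tangent dot iota (g t) y -> `|y| <= 1 ->
      - (4 * (eps / delta)) <= 'd phi (g t) y.
    by move=> yt y1; rewrite leNgt; apply/negP => yk; apply: no_y; exists y.
  move=> y yt y1; rewrite ler_norml bound//=.
  have dN : 'd phi (g t) (- y) = - 'd phi (g t) y :> R by exact: linearN.
  rewrite -lerN2 -dN bound ?normrN//.
  by move: yt; rewrite /tangent /= !linearN /= => ->; rewrite oppr0.
have [|g' [h [h0 g'_path g'_dist g'_max]]] := descent dot_norm iota_cont phi_C1
  _ _ _ k0 g_path p0A p1A _ steep.
  by lra.
have : path_max phi g <= path_max phi g'.
  apply: g_min => // t.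
  have : eps / delta * `|g' t - g t| <= eps / delta * (h * 2).
    by rewrite ler_wpM2l ?g'_dist// ltW.
  move: g'_max; lra.
have : 0 < h * (2 * (eps / delta)) by rewrite mulr_gt0// mulr_gt0.
by move: g'_max; lra.
Qed.

Theorem theorem2p14 (R : realType) (H E : completeNormedModType R)
    (dot : {dot H for idfun}) (iota : {linear E -> H})
    (dot_norm : forall h : H, dot h h = `|h| ^+ 2)
    (H_inf : infinite_dimensional H) (E_inf : infinite_dimensional E)
    (EHE : embedded_triple dot iota)
    (theta : R) (phi : E * R -> R) (phi_C1 : C1 phi)
    (Upsilon : set (E * R)) (Upsilon_sub : Upsilon `<=` sphereR iota)
    (Upsilon_closed : closed (Upsilon : set (subspace (sphereR iota)))) :
  let Gamma := paths iota Upsilon phi theta in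
  let a := minimax_level phi Gamma in
  let b := endpoint_level phi Gamma in
  (b < a)%E ->
  forall (eps delta : R) (gamma : R -> E * R),
    0 < eps -> (eps%:E < (a - b) * (2^-1)%:E)%E -> 0 < delta ->
    Gamma gamma -> (path_sup phi gamma <= a + eps%:E)%E ->
  exists2 x : E * R, sphereR iota x &
    [/\ (a - (2 * eps)%:E <= (phi x)%:E <= a + (2 * eps)%:E)%E,
        (path_dist x gamma <= (2 * delta)%:E)%E &
        (constrained_diff_norm dot iota phi x <= (8 * eps / delta)%:E)%E].
Proof.
move=> Gamma a b ba eps delta gamma e0 e_lt d0 gammaG gamma_sup.
have [_ iota_cont _ _] := EHE.
have [gamma_cont gamma_sphere gamma0 gamma1] := gammaG.
pose g0 := gamma \o clamp.
have g0E t : 0 <= t <= 1 -> g0 t = gamma t.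
  by move=> /clamp_id t01; rewrite /g0 /= t01.
have E0 : g0 0 = gamma 0 by apply: g0E; rewrite lexx ler01.
have E1 : g0 1 = gamma 1 by apply: g0E; rewrite lexx ler01.
have g0_path : sphere_path iota (gamma 0) (gamma 1) g0.
  split => //; first exact: continuous_clamp_comp.
  - move=> t; apply: gamma_sphere; exists (clamp t) => //.
    by rewrite /= in_itv /= clamp_itv.
  - by move=> t; rewrite /g0 /= clampK.
have path_Gamma g : sphere_path iota (gamma 0) (gamma 1) g -> Gamma g.
  move=> [g_cont g_sphere _ g_0 g_1]; split; rewrite ?g_0 ?g_1//.
  - exact: continuous_subspaceT.
  - by move=> _ [t _ <-].
have path_supE g : sphere_path iota (gamma 0) (gamma 1) g ->
    path_sup phi g = (path_max phi g)%:E.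
  move=> g_path; apply/le_anti/andP; split.
    apply: ge_ereal_sup => _ [t _ <-]; rewrite lee_fin.
    exact: (le_path_max phi_C1 _ _ g_path).
  have [t t01 [-> _]] := path_max_attained phi_C1 _ g_path.
  by apply: ereal_sup_ubound; exists t => //=; rewrite in_itv.
have sup_g0 : path_sup phi gamma = (path_max phi g0)%:E.
  rewrite -(path_supE _ g0_path) /path_sup; congr ereal_sup.
  by apply: eq_imagel => t; rewrite /= in_itv /= => /g0E ->.
have a_le : (a <= path_sup phi gamma)%E.
  by apply: ereal_inf_lbound; exists gamma.
have b_ge : ((Num.max (phi (gamma 0)) (phi (gamma 1)))%:E <= b)%E.
  by apply: ereal_sup_ubound; exists gamma.
have a_fin : a \is a fin_num.
  rewrite fin_real// (lt_trans _ ba) ?(lt_le_trans _ b_ge) ?ltNyr//=.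
  by rewrite (le_lt_trans a_le)// sup_g0 ltry.
have b_fin : b \is a fin_num.
  rewrite fin_real// (lt_le_trans _ b_ge) ?ltNyr//= (lt_trans ba)//.
  by rewrite (le_lt_trans a_le)// sup_g0 ltry.
have aE := fineK a_fin; have bE := fineK b_fin.
rewrite -aE in gamma_sup e_lt *; rewrite -bE in b_ge e_lt.
set A := fine a in aE gamma_sup e_lt *; set B := fine b in bE b_ge e_lt.
have eAB : eps < (A - B) / 2 by move: e_lt; rewrite -EFinB -EFinM lte_fin.
rewrite lee_fin ge_max in b_ge; case/andP: b_ge => b0 b1.
have [||||x [x_sphere x_level [t t01 x_dist] x_slope]] :=
  sphere_minimax dot_norm iota_cont phi_C1 A eps delta g0 e0 d0 _ g0_path.
- move=> g g_path; rewrite -lee_fin aE -path_supE//.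
  by apply: ereal_inf_lbound; exists g => //; exact: path_Gamma.
- by rewrite -lee_fin -sup_g0 EFinD.
- lra.
- lra.
exists x => //; split.
- rewrite -EFinB -EFinD !lee_fin; case/andP: x_level => -> /= xA; lra.
- apply: le_trans (_ : (prod_norm (x - gamma t))%:E <= _)%E.
    by apply: ereal_inf_lbound; exists t => //=; rewrite in_itv.
  rewrite lee_fin -g0E//; apply: le_trans (prod_norm_le _ _ _) _.
  by rewrite ler_wpM2l.
- apply: ge_ereal_sup => _ [y [y_tan y1] <-]; rewrite lee_fin.
  have y_norm : `|y| <= 1 by rewrite -y1 norm_le_prod_norm.
  apply: le_trans (x_slope y y_tan y_norm) _.
  have : 0 < eps / delta by rewrite divr_gt0.
  by rewrite -mulrA; lra.
Qed.
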